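(* Let $a_3>0$, $a_4<0$, $c>0$, $\mathfrak R>0$ and $T_c>0$ be real constants, and consider, for $T>T_c$ and $A:\mathbb{R}\to\mathbb{C}$, the time-independent Ginzburg-Landau equation $$a_3(T-T_c)A-a_4\mathfrak R^2\frac{d^2A}{dy^2}-cA|A|^2=0 .\qquad (\ast)$$ For every $T>T_c$, in addition to the constant solutions: (i) There is a one-parameter family of solutions of $(\ast)$ on $\mathbb{R}$ (up to multiplication by a constant phase $e^{i\theta_0}$), bifurcating supercritically, for which $|A|>0$ is constant (independent of $y$) and the phase of $A$ is linear in $y$, i.e. $A(y)=\rho e^{i(\beta y+\theta_0)}$ with $\rho>0$ constant and $\beta$ ranging over the nonzero numbers of an open interval containing $0$. (ii) There is a bifurcating two-parameter family of solutions of $(\ast)$ on $\mathbb{R}$ (up to multiplication by a constant phase and translation in $y$), parametrized by a nonempty open subset of $\mathbb{R}^2$, of the form $A(y)=\rho(y)e^{i\theta(y)}$, where $\rho=|A|>0$ is a nonconstant periodic function of $y$ and $\theta(y)=\beta' y+\theta_0+\phi(y)$ with $\beta',\theta_0\in\mathbb{R}$ constants and $\phi$ a nonconstant periodic function with the same period as $\rho$.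
   Context: A family of solutions defined for each $T>T_c$ is said to bifurcate (supercritically) if it consists of nonzero bounded solutions existing for $T>T_c$, and the supremum of $\sup_{y\in\mathbb{R}}|A(y)|$ over the family tends to $0$ as $T\to T_c^+$. Members of a family with different parameter values are not obtained from each other by multiplication by a constant phase $e^{i\theta_0}$ (nor, in (ii), by a combination of such a multiplication and a translation $y\mapsto y+y_0$). *)

(* Defs.v *)
From Stdlib Require Import Reals.
From Coquelicot Require Export Coquelicot.
Open Scope R_scope.

Definition cis (t : R) : C := (cos t, sin t).

(* [R -> C] functions are differentiated for the real normed module structure
   of [C]. *)
Definition gl_solution (a3 a4 c Rf Tc T : R) (A : R -> C) : Prop :=
  exists dA ddA : R -> C,
    forall y : R,
      is_derive (K := R_AbsRing) (V := C_R_NormedModule) A y (dA y) /\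
      is_derive (K := R_AbsRing) (V := C_R_NormedModule) dA y (ddA y) /\
      (RtoC (a3 * (T - Tc)) * A y - RtoC (a4 * Rf ^ 2) * ddA y
        - RtoC c * A y * RtoC (Cmod (A y) ^ 2) = 0)%C.

Definition nonconstant {X : Type} (f : R -> X) : Prop :=
  exists y z : R, f y <> f z.

Definition least_period {X : Type} (f : R -> X) (P : R) : Prop :=
  0 < P /\ (forall y, f (y + P) = f y) /\
  forall Q, 0 < Q < P -> ~ (forall y, f (y + Q) = f y).

Definition phase_equiv (A B : R -> C) : Prop :=
  exists t0 : R, forall y, B y = (cis t0 * A y)%C.

Definition phase_translation_equiv (A B : R -> C) : Prop :=
  exists t0 y0 : R, forall y, B y = (cis t0 * A (y + y0)%R)%C.

(* The supremum over the whole family at parameter value [T], over both the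
   member [p] and the point [y]. *)
Definition family_sup {Par : Type} (Om : R -> Par -> Prop)
    (A : R -> Par -> R -> C) (T : R) : Rbar :=
  Lub_Rbar (fun r => exists (p : Par) (y : R), Om T p /\ r = Cmod (A T p y)).

(* [Om T] is the parameter domain at [T], [A T p] the member with parameter [p],
   and [equ] the relation that distinct members must not satisfy.  Continuity
   in [p] is what makes the number of parameters meaningful: without it a
   bijection between R and R^2 would turn one parameter into two. *)
Definition bifurcating_family (a3 a4 c Rf Tc : R) {Par : UniformSpace}
    (equ : (R -> C) -> (R -> C) -> Prop)
    (Om : R -> Par -> Prop) (A : R -> Par -> R -> C) : Prop :=
  (forall (T : R) (p : Par), Tc < T -> Om T p ->
     gl_solution a3 a4 c Rf Tc T (A T p) /\
     (exists y, A T p y <> RtoC 0) /\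
     (exists M : R, forall y, Cmod (A T p y) <= M)) /\
  (forall T y : R, Tc < T -> continuous_on (Om T) (fun p => A T p y)) /\
  (forall (T : R) (p q : Par), Tc < T -> Om T p -> Om T q -> p <> q ->
     ~ equ (A T p) (A T q)) /\
  (* [real] sends infinities to 0, so finiteness is asserted separately. *)
  at_right Tc (fun T => is_finite (family_sup Om A T)) /\
  filterlim (fun T => real (family_sup Om A T)) (at_right Tc) (locally 0).

(* Main.v *)
(** In polar form [A = rho e^(i theta)] the equation conserves the momentum
    [h = rho^2 theta'] and an energy, so that [u = rho^2] satisfies
    [u'^2 / 4 = K (u - u1) (u - u2) (u - u3)] with [u1 + u2 + u3] fixed by [T].
    For [0 < u1 < u2 < u3] the modulus oscillates between [u1] and [u2], and
    [theta'] is periodic with nonzero mean, which gives the two-parameter family;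
    constant [u] gives the plane waves.  All moduli are at most
    [sqrt (a3 (T - Tc) / c)], whence the bifurcation from [0]. *)
Require Import Defs.
From Stdlib Require Import Reals Lra FunctionalExtensionality ClassicalEpsilon.
From Coquelicot Require Import Coquelicot.
Open Scope R_scope.

(** The relation for [u'] degenerates at the turning points [u1] and [u2]: the square root vanishes
    there and constant [u] satisfies the same first-order equation, so a single quadrature in [u]
    cannot be inverted globally. An angle [psi] that advances by [PI] per oscillation removes the
    degeneracy. In this angle [dy/dpsi] is periodic and bounded below by a positive constant, its
    primitive is a bijection of the line, and the inverse yields a solution for all [y] with no
    existence theorem for differential equations. The period and the mean phase speed become
    increments of primitives over [PI]. Continuity in [(u1, u2)] has the same source: the integrands
    vary uniformly with the parameters, and at fixed [T] one lower bound for [dy/dpsi] serves all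
    members. *)

(** * The equation in polar form *)

Lemma is_derive_pair (f g : R -> R) (y df dg : R) :
  is_derive f y df -> is_derive g y dg ->
  is_derive (K := R_AbsRing) (V := C_R_NormedModule)
    (fun x => (f x, g x) : C) y ((df, dg) : C).
Proof.
  intros Hf Hg.
  assert (Hpair : forall a b : R,
    plus (scal a (1, 0)) (scal b (0, 1)) = (a, b) :> C_R_NormedModule).
  { intros a b. apply injective_projections; cbn; ring. }
  rewrite <- (Hpair df dg).
  apply is_derive_ext with
    (fun x => plus (scal (f x) ((1, 0) : C_R_NormedModule)) (scal (g x) (0, 1))).
  { intros x. apply Hpair. }
  apply (is_derive_plus (K := R_AbsRing) (V := C_R_NormedModule));
    apply (is_derive_scal_l (K := R_AbsRing) (V := C_R_NormedModule));
    assumption.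
Qed.

Lemma polar_pair (r t : R) : (RtoC r * cis t)%C = (r * cos t, r * sin t).
Proof. unfold cis, Cmult, RtoC; simpl; f_equal; ring. Qed.

Lemma Cmod_polar (r t : R) : 0 <= r -> Cmod (RtoC r * cis t)%C = r.
Proof.
  intros Hr. rewrite Cmod_mult, Cmod_R, (Rabs_pos_eq r Hr).
  unfold cis, Cmod; simpl fst; simpl snd.
  replace (cos t ^ 2 + sin t ^ 2) with 1.
  - rewrite sqrt_1; ring.
  - rewrite <- (sin2_cos2 t); unfold Rsqr; ring.
Qed.

(* In polar form [u = |A|^2], the equation has the first integrals
   [h = u theta'] and [E = |A'|^2 + L u - K u^2]. *)
Lemma polar_gl_solution (a3 a4 c Rf Tc T L K E h : R) (u v theta : R -> R) :
  L * (- a4 * Rf ^ 2) = a3 * (T - Tc) ->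
  2 * K * (- a4 * Rf ^ 2) = c ->
  (forall y, 0 < u y) ->
  (forall y, is_derive u y (v y)) ->
  (forall y, is_derive v y (2 * E - 4 * L * u y + 6 * K * u y ^ 2)) ->
  (forall y, is_derive theta y (h / u y)) ->
  (forall y, v y ^ 2 / 4 + h ^ 2 = E * u y - L * u y ^ 2 + K * u y ^ 3) ->
  gl_solution a3 a4 c Rf Tc T (fun y => RtoC (sqrt (u y)) * cis (theta y))%C.
Proof.
  intros HL HK Hu Du Dv Dt Hint.
  set (r := fun y => sqrt (u y)).
  assert (Hr : forall y, 0 < r y) by (intros y; apply sqrt_lt_R0, Hu).
  assert (Hr2 : forall y, u y = r y * r y)
    by (intros y; unfold r; symmetry; apply sqrt_sqrt, Rlt_le, Hu).
  assert (Dr : forall y, is_derive r y (v y / (2 * r y)))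
    by (intros y; apply is_derive_sqrt; [apply Du | apply Hu]).
  (* This is [(r' + i r theta') e^(i theta)] with [r theta' = h / r]. *)
  exists (fun y => (v y / (2 * r y) * cos (theta y) - h / r y * sin (theta y),
                    v y / (2 * r y) * sin (theta y) + h / r y * cos (theta y))).
  (* Conservation of [h = r^2 theta'] makes the angular component [2 r' theta' + r theta''] vanish,
     so a real multiple of [e^(i theta)] remains. *)
  exists (fun y => ((- L * r y + 2 * K * r y ^ 3) * cos (theta y),
                    (- L * r y + 2 * K * r y ^ 3) * sin (theta y))).
  intros y.
  assert (Eu : ex_derive u y) by (eexists; apply Du).
  assert (Ev : ex_derive v y) by (eexists; apply Dv).
  assert (Er : ex_derive r y) by (eexists; apply Dr).
  assert (Et : ex_derive theta y) by (eexists; apply Dt).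
  assert (Ry := Hr y).
  split; [|split].
  - apply (is_derive_ext
      (fun y => (r y * cos (theta y), r y * sin (theta y)) : C_R_NormedModule)).
    { intros t. symmetry. apply polar_pair. }
    apply is_derive_pair; auto_derive; auto;
      rewrite (is_derive_unique (fun x : R => r x) _ _ (Dr y)), (is_derive_unique (fun x : R => theta x) _ _ (Dt y)),
        Hr2; field; lra.
  - assert (Hv2 : v y ^ 2 =
      4 * (E * r y ^ 2 - L * r y ^ 4 + K * r y ^ 6 - h ^ 2)).
    { specialize (Hint y). rewrite Hr2 in Hint. lra. }
    (* The radial equation [r'' - r theta'^2 = - L r + 2 K r^3]; the energy relation eliminates
       [v^2] from its left side. *)
    assert (Hsecond : (2 * E - 4 * L * u y + 6 * K * u y ^ 2) / (2 * r y)
        - v y ^ 2 / (4 * r y ^ 3) - h ^ 2 / r y ^ 3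
        = - L * r y + 2 * K * r y ^ 3).
    { rewrite Hv2, Hr2. field. lra. }
    apply is_derive_pair; auto_derive;
      try (repeat split; auto; lra);
      rewrite (is_derive_unique (fun x : R => r x) _ _ (Dr y)), (is_derive_unique (fun x : R => theta x) _ _ (Dt y)),
        (is_derive_unique (fun x : R => v x) _ _ (Dv y)), <- Hsecond, Hr2; field; lra.
  - change (sqrt (u y)) with (r y).
    rewrite Cmod_polar by lra. rewrite polar_pair, <- HL, <- HK.
    apply injective_projections; simpl; ring.
Qed.

(** * Primitives of positive functions and their inverses *)

Lemma is_derive_mvt (f df : R -> R) (a b : R) :
  (forall x, is_derive f x (df x)) ->
  exists xi, Rmin a b <= xi <= Rmax a b /\ f b - f a = df xi * (b - a).
Proof.
  intros Hf. apply MVT_gen.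
  - intros x _. apply Hf.
  - intros x _. apply continuity_pt_filterlim.
    apply (ex_derive_continuous (V := R_NormedModule)). eexists. apply Hf.
Qed.

Definition primitive (f : R -> R) (s : R) : R := RInt f 0 s.

(** Choice makes this total in [f]; it is a true inverse once [f] is continuous and bounded below by
    a positive constant. *)
Definition primitive_inv (f : R -> R) (y : R) : R :=
  epsilon (inhabits 0) (fun s => primitive f s = y).

Lemma primitive_0 (f : R -> R) : primitive f 0 = 0.
Proof. apply (RInt_point 0 f). Qed.

Lemma is_derive_primitive (f : R -> R) (s : R) :
  (forall t, continuous f t) -> is_derive (primitive f) s (f s).
Proof.
  intros Hf. apply is_derive_RInt with 0; [|apply Hf].
  apply filter_forall. intros x. apply (RInt_correct f).
  apply (ex_RInt_continuous (V := R_CompleteNormedModule)). intros; apply Hf.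
Qed.

(** The increment over one period has derivative [f (s + p) - f s = 0], so it does not depend on its
    starting point. This yields the period of the modulus and splits the linear drift off the
    phase. *)
Lemma primitive_periodic (f : R -> R) (p s : R) :
  (forall t, continuous f t) -> (forall t, f (t + p) = f t) ->
  primitive f (s + p) = primitive f s + primitive f p.
Proof.
  intros Hf Hp.
  destruct (is_derive_mvt (fun t => primitive f (t + p) - primitive f t)
    (fun _ => 0) 0 s) as [xi [_ H]].
  - intros x.
    replace 0 with (minus (scal 1 (f (x + p))) (f x))
      by (rewrite Hp; unfold minus, plus, opp, scal; cbn; unfold mult; cbn; ring).
    apply (is_derive_minus (fun t => primitive f (t + p))).
    + apply (is_derive_comp (primitive f) (fun t => t + p)).
      * apply is_derive_primitive, Hf.
      * auto_derive; auto.
    + apply is_derive_primitive, Hf.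
  - rewrite Rplus_0_l, primitive_0 in H. lra.
Qed.

Lemma primitive_expanding (f : R -> R) (m a b : R) :
  (forall t, continuous f t) -> (forall t, m <= f t) -> a <= b ->
  m * (b - a) <= primitive f b - primitive f a.
Proof.
  intros Hf Hm Hab.
  destruct (is_derive_mvt (primitive f) f a b) as [xi [_ H]].
  { intros x. apply is_derive_primitive, Hf. }
  rewrite H. apply Rmult_le_compat_r; [lra | apply Hm].
Qed.

(** Read backwards, this is Lipschitz continuity of the inverse with constant [1 / m], which
    controls its dependence on the argument and on parameters. *)
Lemma primitive_expanding_abs (f : R -> R) (m a b : R) :
  (forall t, continuous f t) -> (forall t, m <= f t) ->
  m * Rabs (b - a) <= Rabs (primitive f b - primitive f a).
Proof.
  intros Hf Hm. destruct (Rle_dec a b) as [H|H].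
  - rewrite (Rabs_pos_eq (b - a)) by lra.
    eapply Rle_trans; [|apply Rle_abs].
    apply primitive_expanding; auto.
  - rewrite (Rabs_minus_sym b a), (Rabs_minus_sym (primitive f b)).
    rewrite (Rabs_pos_eq (a - b)) by lra.
    eapply Rle_trans; [|apply Rle_abs].
    apply primitive_expanding; auto; lra.
Qed.

Lemma primitive_lt (f : R -> R) (m a b : R) :
  (forall t, continuous f t) -> 0 < m -> (forall t, m <= f t) -> a < b ->
  primitive f a < primitive f b.
Proof.
  intros Hf Hm0 Hm Hab.
  assert (H := primitive_expanding f m a b Hf Hm (Rlt_le _ _ Hab)).
  assert (0 < m * (b - a)) by (apply Rmult_lt_0_compat; lra). lra.
Qed.

Lemma primitive_inv_r (f : R -> R) (m y : R) :
  (forall t, continuous f t) -> 0 < m -> (forall t, m <= f t) ->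
  primitive f (primitive_inv f y) = y.
Proof.
  intros Hf Hm0 Hm. unfold primitive_inv. apply epsilon_spec.
  (* Growth at rate at least [m] carries the primitive to [|y|] or beyond at [b] and to [-|y|] or
     below at [-b]. *)
  set (b := Rabs y / m).
  assert (Hb : 0 <= b)
    by (apply Rdiv_le_0_compat; [apply Rabs_pos | assumption]).
  assert (Hmb : m * b = Rabs y) by (unfold b; field; lra).
  assert (H1 := primitive_expanding f m 0 b Hf Hm Hb).
  assert (H2 := primitive_expanding f m (- b) 0 Hf Hm ltac:(lra)).
  rewrite primitive_0 in H1, H2.
  assert (H3 := Rle_abs y). assert (H4 := Rle_abs (- y)).
  rewrite Rabs_Ropp in H4.
  destruct (IVT_gen (primitive f) (- b) b y) as [s [_ Hs]].
  - intros x. apply continuity_pt_filterlim.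
    apply (ex_derive_continuous (V := R_NormedModule)). eexists.
    apply is_derive_primitive, Hf.
  - rewrite Rmin_left, Rmax_right by lra. lra.
  - exists s; exact Hs.
Qed.

Lemma primitive_inj (f : R -> R) (m a b : R) :
  (forall t, continuous f t) -> 0 < m -> (forall t, m <= f t) ->
  primitive f a = primitive f b -> a = b.
Proof.
  intros Hf Hm0 Hm Hab.
  destruct (Rtotal_order a b) as [H|[H|H]]; [|exact H|];
    apply (primitive_lt f m) in H; auto; lra.
Qed.

Lemma primitive_inv_l (f : R -> R) (m s : R) :
  (forall t, continuous f t) -> 0 < m -> (forall t, m <= f t) ->
  primitive_inv f (primitive f s) = s.
Proof.
  intros Hf Hm0 Hm. apply (primitive_inj f m); auto.
  apply primitive_inv_r with m; auto.
Qed.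

(** By the mean value theorem the difference quotient of the inverse is exactly [1 / f xi] for some
    [xi] between the two inverse values; expansion forces [xi] towards [psi y], and [1 / f] is
    continuous there. *)
Lemma is_derive_primitive_inv (f : R -> R) (m y : R) :
  (forall t, continuous f t) -> 0 < m -> (forall t, m <= f t) ->
  is_derive (primitive_inv f) y (/ f (primitive_inv f y)).
Proof.
  intros Hf Hm0 Hm. set (psi := primitive_inv f).
  assert (Hpsi : forall z, primitive f (psi z) = z)
    by (intros z; apply primitive_inv_r with m; auto).
  apply is_derive_Reals. intros eps Heps.
  assert (Hc : continuous (fun t => / f t) (psi y)).
  { apply continuous_comp; [apply Hf|].
    apply continuous_Rinv. specialize (Hm (psi y)). lra. }
  apply filterlim_locally with (eps := mkposreal eps Heps) in Hc.
  destruct Hc as [d Hd].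
  assert (Hd' : 0 < m * d) by (apply Rmult_lt_0_compat; [lra | apply cond_pos]).
  exists (mkposreal _ Hd'). intros k Hk0 Hk. cbn in Hk.
  destruct (is_derive_mvt (primitive f) f (psi y) (psi (y + k)))
    as [xi [Hxi H]].
  { intros x. apply is_derive_primitive, Hf. }
  rewrite !Hpsi in H.
  assert (Hfx := Hm xi).
  replace ((psi (y + k) - psi y) / k) with (/ f xi).
  2: { replace k with (f xi * (psi (y + k) - psi y)) at 2 by lra.
       field. split; [|lra].
       intros H0. rewrite H0 in H. lra. }
  apply (Hd xi).
  assert (He := primitive_expanding_abs f m (psi y) (psi (y + k)) Hf Hm).
  rewrite !Hpsi in He. replace (y + k - y) with k in He by ring.
  assert (Hlt : Rabs (psi (y + k) - psi y) < d)
    by (apply Rmult_lt_reg_l with m; lra).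
  change (Rabs (xi - psi y) < d). eapply Rle_lt_trans; [|exact Hlt].
  unfold Rmin, Rmax in Hxi. destruct (Rle_dec (psi y) (psi (y + k))).
  - rewrite !Rabs_pos_eq; lra.
  - rewrite !Rabs_left1; lra.
Qed.

(** * Continuous dependence on parameters *)

(** Uniformity in [s] lets continuity in the parameter pass through an integral whose end point also
    moves. Boundedness at [q] is included to make the notion stable under products. *)
Definition unif_continuous_at {Par : UniformSpace} (g : Par -> R -> R) (q : Par)
    : Prop :=
  (exists M : R, forall s, Rabs (g q s) <= M) /\
  forall eps : posreal,
    locally q (fun p => forall s, Rabs (g p s - g q s) < eps).

Lemma unif_continuous_param {Par : UniformSpace} (a : Par -> R) (q : Par) :
  continuous a q -> unif_continuous_at (fun p _ => a p) q.
Proof.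
  intros Ha. split; [exists (Rabs (a q)); intros _; lra|].
  intros eps. assert (H := proj1 (filterlim_locally a (a q)) Ha eps).
  revert H. apply filter_imp. intros p Hp _. exact Hp.
Qed.

Lemma unif_continuous_indep {Par : UniformSpace} (k : R -> R) (q : Par) (M : R) :
  (forall s, Rabs (k s) <= M) -> unif_continuous_at (fun _ => k) q.
Proof.
  intros HM. split; [exists M; exact HM|].
  intros eps. apply filter_forall. intros _ s.
  rewrite Rminus_diag, Rabs_R0. apply cond_pos.
Qed.

Lemma unif_continuous_ext {Par : UniformSpace} (f g : Par -> R -> R) (q : Par) :
  (forall p s, f p s = g p s) ->
  unif_continuous_at f q -> unif_continuous_at g q.
Proof.
  intros H [[M HM] Hf]. split.
  - exists M. intros s. rewrite <- H. apply HM.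
  - intros eps. generalize (Hf eps). apply filter_imp.
    intros p Hp s. rewrite <- !H. apply Hp.
Qed.

Lemma unif_continuous_plus {Par : UniformSpace} (f g : Par -> R -> R) (q : Par) :
  unif_continuous_at f q -> unif_continuous_at g q ->
  unif_continuous_at (fun p s => f p s + g p s) q.
Proof.
  intros [[M HM] Hf] [[N HN] Hg]. split.
  - exists (M + N). intros s. eapply Rle_trans; [apply Rabs_triang|].
    apply Rplus_le_compat; auto.
  - intros eps.
    generalize (filter_and _ _ (Hf (pos_div_2 eps)) (Hg (pos_div_2 eps))).
    apply filter_imp.
    intros p [H1 H2] s. specialize (H1 s). specialize (H2 s). cbn in H1, H2.
    replace (f p s + g p s - (f q s + g q s))
      with ((f p s - f q s) + (g p s - g q s)) by ring.
    eapply Rle_lt_trans; [apply Rabs_triang|]. lra.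
Qed.

Lemma unif_continuous_mult {Par : UniformSpace} (f g : Par -> R -> R) (q : Par) :
  unif_continuous_at f q -> unif_continuous_at g q ->
  unif_continuous_at (fun p s => f p s * g p s) q.
Proof.
  intros [[M HM] Hf] [[N HN] Hg].
  assert (HM0 : 0 <= M) by (eapply Rle_trans; [apply Rabs_pos | apply (HM 0)]).
  assert (HN0 : 0 <= N) by (eapply Rle_trans; [apply Rabs_pos | apply (HN 0)]).
  split.
  - exists (M * N). intros s. rewrite Rabs_mult.
    apply Rmult_le_compat; auto using Rabs_pos.
  - intros eps.
    (* With [d <= 1] the three terms of the expansion below add up to at most [d (1 + M + N)],
       strictly less than [d (M + N + 2)]. *)
    assert (Hd : 0 < Rmin 1 (eps / (M + N + 2))).
    { apply Rmin_pos; [lra | apply Rdiv_lt_0_compat; [apply cond_pos | lra]]. }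
    set (d := mkposreal _ Hd).
    assert (Hd1 : d <= 1) by apply Rmin_l.
    assert (Hde : d * (M + N + 2) <= eps).
    { apply Rmult_le_reg_r with (/ (M + N + 2));
        [apply Rinv_0_lt_compat; lra|].
      rewrite Rmult_assoc, Rinv_r, Rmult_1_r by lra. apply Rmin_r. }
    generalize (filter_and _ _ (Hf d) (Hg d)). apply filter_imp.
    intros p [H1 H2] s. specialize (H1 s). specialize (H2 s).
    specialize (HM s). specialize (HN s).
    assert (Hdp := cond_pos d).
    replace (f p s * g p s - f q s * g q s)
      with ((f p s - f q s) * (g p s - g q s)
        + (f q s * (g p s - g q s) + g q s * (f p s - f q s))) by ring.
    eapply Rle_lt_trans; [apply Rabs_triang|].
    eapply Rle_lt_trans; [apply Rplus_le_compat_l, Rabs_triang|].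
    rewrite !Rabs_mult.
    assert (Rabs (f p s - f q s) * Rabs (g p s - g q s) <= 1 * d)
      by (apply Rmult_le_compat; try apply Rabs_pos; lra).
    assert (Rabs (f q s) * Rabs (g p s - g q s) <= M * d)
      by (apply Rmult_le_compat; try apply Rabs_pos; lra).
    assert (Rabs (g q s) * Rabs (f p s - f q s) <= N * d)
      by (apply Rmult_le_compat; try apply Rabs_pos; lra).
    nra.
Qed.

Lemma unif_continuous_inv {Par : UniformSpace} (f : Par -> R -> R) (q : Par)
    (m : R) :
  0 < m -> (forall s, m <= f q s) -> unif_continuous_at f q ->
  unif_continuous_at (fun p s => / f p s) q.
Proof.
  intros Hm0 Hm [_ Hf]. split.
  - exists (/ m). intros s. specialize (Hm s).
    rewrite Rabs_pos_eq; [apply Rinv_le_contravar; lra|].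
    apply Rlt_le, Rinv_0_lt_compat; lra.
  - intros eps.
    (* A deviation below [m / 2] keeps [f p s] above [m / 2], so the common denominator of the two
       inverses is at least [m^2 / 2]. *)
    assert (Hd : 0 < Rmin (m / 2) (eps * (m * m / 2))).
    { apply Rmin_pos; [lra|]. apply Rmult_lt_0_compat; [apply cond_pos | nra]. }
    set (d := mkposreal _ Hd).
    assert (Hd1 : d <= m / 2) by apply Rmin_l.
    assert (Hde : d <= eps * (m * m / 2)) by apply Rmin_r.
    generalize (Hf d). apply filter_imp. intros p H s.
    specialize (H s). specialize (Hm s). apply Rabs_def2 in H as H'.
    assert (Hp : m / 2 <= f p s) by lra.
    assert (Hpq : m * m / 2 <= f p s * f q s) by nra.
    replace (/ f p s - / f q s) with (- (f p s - f q s) / (f p s * f q s))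
      by (field; split; lra).
    unfold Rdiv. rewrite Rabs_mult, Rabs_Ropp, Rabs_inv,
      (Rabs_pos_eq (f p s * f q s)) by nra.
    apply Rmult_lt_reg_r with (f p s * f q s); [nra|].
    rewrite Rmult_assoc, Rinv_l, Rmult_1_r by nra.
    assert (eps * (m * m / 2) <= eps * (f p s * f q s))
      by (apply Rmult_le_compat_l; [apply Rlt_le, cond_pos | exact Hpq]).
    lra.
Qed.

Lemma unif_continuous_sqrt {Par : UniformSpace} (f : Par -> R -> R) (q : Par)
    (m : R) :
  0 < m -> (forall s, m <= f q s) -> unif_continuous_at f q ->
  unif_continuous_at (fun p s => sqrt (f p s)) q.
Proof.
  intros Hm0 Hm [[M HM] Hf]. split.
  - exists (sqrt M). intros s. rewrite Rabs_pos_eq by apply sqrt_pos.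
    apply sqrt_le_1_alt. eapply Rle_trans; [apply Rle_abs | apply HM].
  - intros eps.
    assert (Hsm : 0 < sqrt m) by (apply sqrt_lt_R0; assumption).
    (* The bound [m] keeps [f p s] positive; the other one serves the quotient of [f p s - f q s] by
       the sum of the roots, a sum at least [sqrt m]. *)
    assert (Hd : 0 < Rmin m (eps * sqrt m)).
    { apply Rmin_pos; [lra|].
      apply Rmult_lt_0_compat; [apply cond_pos | assumption]. }
    set (d := mkposreal _ Hd).
    assert (Hd1 : d <= m) by apply Rmin_l.
    assert (Hde : d <= eps * sqrt m) by apply Rmin_r.
    generalize (Hf d). apply filter_imp. intros p H s.
    specialize (H s). specialize (Hm s). apply Rabs_def2 in H as H'.
    assert (H1 : sqrt m <= sqrt (f q s)) by (apply sqrt_le_1_alt, Hm).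
    assert (H2 := sqrt_pos (f p s)).
    assert (Hprod : f p s - f q s =
      (sqrt (f p s) - sqrt (f q s)) * (sqrt (f p s) + sqrt (f q s))).
    { rewrite <- (sqrt_sqrt (f p s)) at 1 by lra.
      rewrite <- (sqrt_sqrt (f q s)) at 1 by lra. ring. }
    rewrite Hprod, Rabs_mult in H.
    rewrite (Rabs_pos_eq (sqrt (f p s) + sqrt (f q s))) in H by lra.
    assert (H3 := Rabs_pos (sqrt (f p s) - sqrt (f q s))).
    apply Rmult_lt_reg_r with (sqrt m); [assumption|].
    eapply Rle_lt_trans; [|eapply Rlt_le_trans; [exact H | exact Hde]].
    apply Rmult_le_compat_l; lra.
Qed.

Lemma primitive_dist (f g : R -> R) (e s : R) :
  (forall t, continuous f t) -> (forall t, continuous g t) ->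
  (forall t, Rabs (f t - g t) <= e) ->
  Rabs (primitive f s - primitive g s) <= e * Rabs s.
Proof.
  intros Hf Hg He.
  destruct (is_derive_mvt (fun t => primitive f t - primitive g t)
    (fun t => f t - g t) 0 s) as [xi [_ H]].
  { intros x.
    apply (is_derive_minus (primitive f)); apply is_derive_primitive; auto. }
  cbv beta in H. rewrite !primitive_0, !Rminus_0_r in H.
  rewrite H, Rabs_mult. apply Rmult_le_compat_r; [apply Rabs_pos | apply He].
Qed.

(** Replacing the integrand costs its uniform distance times [|psi p|], and [|psi p|] stays below
    [|psi q| + 1] near [q]; what remains is a moving end point for the fixed integrand [f q]. *)
Lemma continuous_primitive_param {Par : UniformSpace} (f : Par -> R -> R)
    (psi : Par -> R) (q : Par) :
  locally q (fun p => forall t, continuous (f p) t) ->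
  unif_continuous_at f q -> continuous psi q ->
  continuous (fun p => primitive (f p) (psi p)) q.
Proof.
  intros Hc [_ Hu] Hpsi. assert (Hcq := locally_singleton _ _ Hc).
  apply filterlim_locally. intros eps.
  assert (Hk : continuous (fun p => primitive (f q) (psi p)) q).
  { apply continuous_comp; [exact Hpsi|].
    apply (ex_derive_continuous (V := R_NormedModule)). eexists.
    apply is_derive_primitive, Hcq. }
  assert (H1 := proj1 (filterlim_locally _ _) Hk (pos_div_2 eps)).
  assert (H2 := proj1 (filterlim_locally _ _) Hpsi (mkposreal 1 Rlt_0_1)).
  assert (HB : 0 < Rabs (psi q) + 1) by (assert (H := Rabs_pos (psi q)); lra).
  assert (Hd : 0 < eps / 2 / (Rabs (psi q) + 1)).
  { apply Rdiv_lt_0_compat; [|exact HB]. assert (H := cond_pos eps). lra. }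
  generalize (filter_and _ _ Hc (filter_and _ _ (Hu (mkposreal _ Hd))
    (filter_and _ _ H1 H2))).
  apply filter_imp. intros p [Hcp [H3 [H4 H5]]].
  change (Rabs (psi p - psi q) < 1) in H5.
  change (Rabs (primitive (f q) (psi p) - primitive (f q) (psi q)) < eps / 2)
    in H4.
  change (Rabs (primitive (f p) (psi p) - primitive (f q) (psi q)) < eps).
  assert (H6 := primitive_dist (f p) (f q) _ (psi p) Hcp Hcq
    (fun t => Rlt_le _ _ (H3 t))).
  cbn [pos] in H6.
  assert (H7 : Rabs (psi p) <= Rabs (psi q) + 1).
  { replace (psi p) with (psi q + (psi p - psi q)) by ring.
    eapply Rle_trans; [apply Rabs_triang | lra]. }
  assert (H8 : eps / 2 / (Rabs (psi q) + 1) * Rabs (psi p) <= eps / 2).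
  { replace (eps / 2) with (eps / 2 / (Rabs (psi q) + 1) * (Rabs (psi q) + 1))
      at 2 by (field; lra).
    apply Rmult_le_compat_l; [lra | exact H7]. }
  replace (primitive (f p) (psi p) - primitive (f q) (psi q))
    with ((primitive (f p) (psi p) - primitive (f q) (psi p))
      + (primitive (f q) (psi p) - primitive (f q) (psi q))) by ring.
  eapply Rle_lt_trans; [apply Rabs_triang | lra].
Qed.

(** At the inverse value [z] belonging to [q], the primitive for [p] is close to [y]. Expansion with
    the common constant [m] converts this into closeness of the inverse values. *)
Lemma continuous_primitive_inv_param {Par : UniformSpace} (f : Par -> R -> R)
    (q : Par) (m y : R) :
  0 < m ->
  locally q (fun p => (forall t, continuous (f p) t) /\ forall t, m <= f p t) ->
  unif_continuous_at f q ->
  continuous (fun p => primitive_inv (f p) y) q.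
Proof.
  intros Hm0 Hloc [_ Hu].
  destruct (locally_singleton _ _ Hloc) as [Hcq Hmq].
  apply filterlim_locally. intros eps.
  set (z := primitive_inv (f q) y).
  assert (HB : 0 < Rabs z + 1) by (assert (H := Rabs_pos z); lra).
  assert (Hme : 0 < m * eps)
    by (apply Rmult_lt_0_compat; [assumption | apply cond_pos]).
  assert (Hd : 0 < m * eps / (Rabs z + 1)) by (apply Rdiv_lt_0_compat; auto).
  generalize (filter_and _ _ Hloc (Hu (mkposreal _ Hd))).
  apply filter_imp. intros p [[Hcp Hmp] H].
  change (Rabs (primitive_inv (f p) y - z) < eps).
  apply Rmult_lt_reg_l with m; [assumption|].
  eapply Rle_lt_trans;
    [apply (primitive_expanding_abs (f p) m z _ Hcp Hmp)|].
  rewrite (primitive_inv_r (f p) m y Hcp Hm0 Hmp).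
  rewrite <- (primitive_inv_r (f q) m y Hcq Hm0 Hmq) at 1. fold z.
  rewrite Rabs_minus_sym.
  eapply Rle_lt_trans;
    [apply (primitive_dist (f p) (f q) _ z Hcp Hcq (fun t => Rlt_le _ _ (H t)))|].
  cbn [pos].
  replace (m * eps) with (m * eps / (Rabs z + 1) * (Rabs z + 1)) at 2
    by (field; lra).
  apply Rmult_lt_compat_l; [exact Hd | lra].
Qed.

Lemma continuous_polar {Par : UniformSpace} (r t : Par -> R) (q : Par) :
  continuous r q -> continuous t q ->
  continuous (fun p => (RtoC (r p) * cis (t p))%C) q.
Proof.
  intros Hr Ht.
  apply (continuous_ext (fun p => (r p * cos (t p), r p * sin (t p)))).
  { intros p. symmetry. apply polar_pair. }
  apply (continuous_comp_2 (V := R_UniformSpace) (W := R_UniformSpace)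
    (X := prod_UniformSpace R_UniformSpace R_UniformSpace)
    (fun p => r p * cos (t p)) (fun p => r p * sin (t p)) pair).
  - apply (continuous_mult (K := R_AbsRing) r); [exact Hr|].
    apply (continuous_comp t cos); [exact Ht | apply continuous_cos].
  - apply (continuous_mult (K := R_AbsRing) r); [exact Hr|].
    apply (continuous_comp t sin); [exact Ht | apply continuous_sin].
  - apply (continuous_ext (fun x => x)); [intros [a b]; reflexivity|].
    apply continuous_id.
Qed.

(** * Bifurcation from zero, and plane waves *)

(** A squeeze between 0 and the square root. A member at each [T] is required because the supremum
    of the empty set is minus infinity. *)
Lemma family_sup_bifurcates {Par : Type} (Om : R -> Par -> Prop)
    (A : R -> Par -> R -> C) (k Tc : R) :
  (forall T, Tc < T -> exists p, Om T p) ->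
  (forall T p y, Tc < T -> Om T p -> Cmod (A T p y) <= sqrt (k * (T - Tc))) ->
  at_right Tc (fun T => is_finite (family_sup Om A T)) /\
  filterlim (fun T => real (family_sup Om A T)) (at_right Tc) (locally 0).
Proof.
  intros Hne Hb.
  assert (Hsup : forall T, Tc < T -> is_finite (family_sup Om A T) /\
    0 <= real (family_sup Om A T) <= sqrt (k * (T - Tc))).
  { intros T HT. unfold family_sup.
    match goal with |- context [Lub_Rbar ?E] =>
      destruct (Lub_Rbar_correct E) as [Hub Hlub]; set (l := Lub_Rbar E) in * end.
    destruct (Hne T HT) as [p Hp].
    assert (H1 : Rbar_le (Cmod (A T p 0)) l) by (apply Hub; exists p, 0; auto).
    assert (H2 : Rbar_le l (sqrt (k * (T - Tc)))).
    { apply Hlub. intros r [p' [y [Hp' ->]]]. apply Hb; auto. }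
    assert (H3 := Cmod_ge_0 (A T p 0)).
    destruct l; cbn in H1, H2; try contradiction.
    split; [reflexivity | cbn; lra]. }
  assert (Hright : at_right Tc (fun T => Tc < T)).
  { exists (mkposreal 1 Rlt_0_1). auto. }
  split.
  - revert Hright. apply filter_imp. intros T HT. apply Hsup, HT.
  - apply (filterlim_le_le (fun _ => 0) _ (fun T => sqrt (k * (T - Tc))) 0).
    + revert Hright. apply filter_imp. intros T HT. apply Hsup, HT.
    + apply filterlim_const.
    (* [sqrt] is 0 on negative arguments, so the upper bound is continuous at [Tc] from both
       sides. *)
    + apply (filterlim_filter_le_1 (F := locally Tc) (G := at_right Tc)).
      { intros P. unfold at_right, within. apply filter_imp. auto. }
      rewrite <- sqrt_0, <- (Rmult_0_r k), <- (Rminus_diag Tc).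
      apply (continuous_sqrt_comp (fun T => k * (T - Tc))).
      apply (ex_derive_continuous (V := R_NormedModule)). auto_derive; auto.
Qed.

(** Constant [|A|^2] corresponds to a double root [u0] of the cubic [K u^3 - L u^2 + E u - h^2]: its
    vanishing derivative fixes [E], the phase speed [beta] fixes [h], and its vanishing is then the
    assumed relation between amplitude and wave number. *)
Lemma plane_wave_gl_solution (a3 a4 c Rf Tc T u0 beta : R) :
  a4 < 0 -> 0 < Rf -> 0 < u0 ->
  c * u0 = a3 * (T - Tc) + a4 * Rf ^ 2 * beta ^ 2 ->
  gl_solution a3 a4 c Rf Tc T (fun y => RtoC (sqrt u0) * cis (beta * y))%C.
Proof.
  intros Ha4 HRf Hu Heq.
  assert (HR2 : 0 < Rf ^ 2) by (apply pow_lt; assumption).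
  assert (Hkap : 0 < - a4 * Rf ^ 2) by (apply Rmult_lt_0_compat; lra).
  set (L := a3 * (T - Tc) / (- a4 * Rf ^ 2)).
  set (K := c / (2 * (- a4 * Rf ^ 2))).
  assert (HLK : L = 2 * K * u0 + beta ^ 2).
  { unfold L, K.
    replace (a3 * (T - Tc)) with (c * u0 - a4 * Rf ^ 2 * beta ^ 2) by lra.
    field. split; lra. }
  apply (polar_gl_solution a3 a4 c Rf Tc T L K (2 * L * u0 - 3 * K * u0 ^ 2)
    (beta * u0) (fun _ => u0) (fun _ => 0)).
  - unfold L. field. split; lra.
  - unfold K. field. split; lra.
  - intros _. exact Hu.
  - intros y. auto_derive; auto.
  - intros y. auto_derive; auto. ring.
  - intros y. auto_derive; auto. field. lra.
  - intros y. rewrite HLK. field.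
Qed.

Lemma cis_neg_mult (a b : R) : (cis (- a) * cis b)%C = cis (b - a).
Proof.
  unfold cis, Cmult; simpl. rewrite cos_neg, sin_neg, cos_minus, sin_minus.
  f_equal; ring.
Qed.

Lemma cis_0 : cis 0 = RtoC 1.
Proof. unfold cis. rewrite cos_0, sin_0. reflexivity. Qed.

(** After division [z e^(i (b' - b) y)] is constant, but a half turn would change its sign. This
    separates plane waves, and with [b = 0] shows that they are nonconstant. *)
Lemma cis_linear_inj (w z : C) (b b' : R) :
  z <> RtoC 0 -> (forall y, z * cis (b' * y) = w * cis (b * y))%C -> b = b'.
Proof.
  intros Hz H.
  assert (H' : forall y, (z * cis ((b' - b) * y) = w)%C).
  { intros y. replace ((b' - b) * y) with (b' * y - b * y) by ring.
    rewrite <- cis_neg_mult.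
    replace (z * (cis (- (b * y)) * cis (b' * y)))%C
      with (cis (- (b * y)) * (z * cis (b' * y)))%C by ring.
    rewrite H.
    replace (cis (- (b * y)) * (w * cis (b * y)))%C
      with (w * (cis (- (b * y)) * cis (b * y)))%C by ring.
    rewrite cis_neg_mult, Rminus_diag, cis_0. apply Cmult_1_r. }
  destruct (Req_dec b' b) as [E|E]; [auto|exfalso].
  assert (H0 := H' 0). assert (H1 := H' (PI / (b' - b))).
  replace ((b' - b) * (PI / (b' - b))) with PI in H1 by (field; lra).
  rewrite Rmult_0_r, <- H1 in H0. unfold cis in H0.
  rewrite cos_0, sin_0, cos_PI, sin_PI in H0.
  apply Hz. destruct z as [z1 z2]. unfold Cmult, RtoC in *; simpl in H0.
  injection H0 as Ha Hb. f_equal; lra.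
Qed.

Lemma least_period_nonconstant {X : Type} (f : R -> X) (P : R) :
  least_period f P -> nonconstant f.
Proof.
  intros [HP [_ Hmin]]. apply NNPP. intros Hn.
  apply (Hmin (P / 2)); [lra|]. intros y. apply NNPP. intros Hy.
  apply Hn. exists (y + P / 2), y. exact Hy.
Qed.

(** * The quasi-periodic solutions *)

(* The quasi-periodic solutions have [|A|^2 = u] with
   [u'^2 / 4 = K (u - u1) (u2 - u) (u3 - u)] and [u1 + u2 + u3 = S], where
   [p = (u1, u2)].  Substituting [u = u1 + (u2 - u1) sin^2 psi] turns this into
   [psi'^2 = K (u3 - u)], whose right-hand side never vanishes. *)
Definition modulus2 (p : R * R) (s : R) : R :=
  fst p + (snd p - fst p) * sin s ^ 2.

Definition speed2 (K S : R) (p : R * R) (s : R) : R :=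
  K * (S - fst p - snd p - modulus2 p s).

(** This is [dy/dpsi]; its primitive is, up to scaling, the incomplete elliptic integral of the
    first kind. *)
Definition dwell (K S : R) (p : R * R) (s : R) : R := / sqrt (speed2 K S p s).

(** The constant term of the cubic gives [h^2 = K u1 u2 u3], with [u3 = S - u1 - u2]. *)
Definition momentum (K S : R) (p : R * R) : R :=
  sqrt (K * (fst p * snd p * (S - fst p - snd p))).

(** This is [dtheta/dpsi], that is [theta' = h / u] times [dy/dpsi]. *)
Definition phase_density (K S : R) (p : R * R) (s : R) : R :=
  momentum K S p * / modulus2 p s * dwell K S p s.

(** The angle [psi] as a function of [y]: Jacobi's amplitude function up to scaling of [y]. *)
Definition amplitude (K S : R) (p : R * R) (y : R) : R :=
  primitive_inv (dwell K S p) y.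

Definition phase (K S : R) (p : R * R) (y : R) : R :=
  primitive (phase_density K S p) (amplitude K S p y).

Definition cnoidal (K S : R) (p : R * R) (y : R) : C :=
  (RtoC (sqrt (modulus2 p (amplitude K S p y))) * cis (phase K S p y))%C.

(** The last inequality says [u2 < u3]. *)
Definition cnoidal_domain (S : R) (p : R * R) : Prop :=
  0 < fst p /\ fst p < snd p /\ fst p + 2 * snd p < S.

Lemma sin_sqr_bounds (s : R) : 0 <= sin s ^ 2 <= 1.
Proof.
  split; [apply pow2_ge_0|].
  assert (H := sin2_cos2 s). unfold Rsqr in H. assert (H' := pow2_ge_0 (cos s)).
  lra.
Qed.

Lemma sin_sqr_add_PI (s : R) : sin (s + PI) ^ 2 = sin s ^ 2.
Proof. rewrite neg_sin. ring. Qed.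

Lemma modulus2_bounds (S : R) (p : R * R) (s : R) :
  cnoidal_domain S p -> fst p <= modulus2 p s <= snd p.
Proof.
  intros [H1 [H2 H3]]. unfold modulus2. assert (H := sin_sqr_bounds s). nra.
Qed.

(** The lower bound is [K (u3 - u2)]: since [u <= u2], the angle never stops. *)
Lemma speed2_bounds (K S : R) (p : R * R) (s : R) :
  0 < K -> cnoidal_domain S p ->
  0 < K * (S - fst p - 2 * snd p) <= speed2 K S p s /\ speed2 K S p s <= K * S.
Proof.
  intros HK Hp. assert (H := modulus2_bounds S p s Hp).
  destruct Hp as [H1 [H2 H3]]. unfold speed2. split; [split|].
  - apply Rmult_lt_0_compat; lra.
  - apply Rmult_le_compat_l; lra.
  - apply Rmult_le_compat_l; lra.
Qed.

Lemma open_cnoidal_domain (S : R) : open (cnoidal_domain S).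
Proof.
  assert (Hf : forall p : R * R, continuous fst p)
    by (intros [a b]; apply continuous_fst).
  assert (Hs : forall p : R * R, continuous snd p)
    by (intros [a b]; apply continuous_snd).
  apply open_and; [|apply open_and].
  - apply (open_comp fst (fun u => 0 < u)); [|apply open_gt].
    intros p _. apply Hf.
  - apply (open_ext (fun p : R * R => snd p - fst p > 0)).
    { intros p. lra. }
    apply (open_comp (fun p : R * R => snd p - fst p) (fun u => 0 < u));
      [|apply open_gt].
    intros p _. apply (continuous_minus (V := R_NormedModule)); auto.
  - apply (open_comp (fun p : R * R => fst p + 2 * snd p) (fun u => u < S));
      [|apply open_lt].
    intros p _.
    apply (continuous_plus (V := R_NormedModule) (fst : R * R -> R)); auto.
    apply (continuous_mult (K := R_AbsRing) (fun _ : R * R => 2) snd p); auto.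
    apply continuous_const.
Qed.

Section Cnoidal.

Variables (K S : R).
Hypothesis HK : 0 < K.

(** Independent of [p], so that a single expansion constant is available on a neighbourhood of each
    parameter. *)
Let lower : R := / sqrt (K * S).

Section Member.

Variable p : R * R.
Hypothesis Hp : cnoidal_domain S p.

Let U (y : R) : R := modulus2 p (amplitude K S p y).

Lemma continuous_dwell (s : R) : continuous (dwell K S p) s.
Proof.
  apply (ex_derive_continuous (V := R_NormedModule)).
  assert (H := speed2_bounds K S p s HK Hp).
  unfold dwell, speed2, modulus2 in *. auto_derive.
  split; [lra | split; [apply Rgt_not_eq, sqrt_lt_R0; lra | exact I]].
Qed.

Lemma continuous_phase_density (s : R) : continuous (phase_density K S p) s.
Proof.
  apply (continuous_mult (K := R_AbsRing)); [|apply continuous_dwell].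
  apply (ex_derive_continuous (V := R_NormedModule)).
  assert (H := modulus2_bounds S p s Hp). destruct Hp as [H1 _].
  unfold modulus2 in *. auto_derive. lra.
Qed.

Lemma lower_pos : 0 < lower.
Proof.
  assert (H := speed2_bounds K S p 0 HK Hp).
  apply Rinv_0_lt_compat, sqrt_lt_R0. lra.
Qed.

Lemma lower_le_dwell (s : R) : lower <= dwell K S p s.
Proof.
  assert (H := speed2_bounds K S p s HK Hp).
  apply Rinv_le_contravar; [apply sqrt_lt_R0; lra|].
  apply sqrt_le_1_alt; lra.
Qed.

Lemma primitive_amplitude (y : R) :
  primitive (dwell K S p) (amplitude K S p y) = y.
Proof.
  apply primitive_inv_r with lower;
    auto using continuous_dwell, lower_pos, lower_le_dwell.
Qed.

Lemma amplitude_primitive (s : R) :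
  amplitude K S p (primitive (dwell K S p) s) = s.
Proof.
  apply primitive_inv_l with lower;
    auto using continuous_dwell, lower_pos, lower_le_dwell.
Qed.

Lemma is_derive_amplitude (y : R) :
  is_derive (amplitude K S p) y (sqrt (speed2 K S p (amplitude K S p y))).
Proof.
  rewrite <- Rinv_inv. apply (is_derive_primitive_inv (dwell K S p) lower);
    auto using continuous_dwell, lower_pos, lower_le_dwell.
Qed.

Lemma is_derive_phase (y : R) :
  is_derive (phase K S p) y (momentum K S p / U y).
Proof.
  set (s := amplitude K S p y).
  assert (H1 := speed2_bounds K S p s HK Hp).
  assert (H2 := modulus2_bounds S p s Hp).
  assert (H3 : 0 < sqrt (speed2 K S p s)) by (apply sqrt_lt_R0; lra).
  assert (H4 : 0 < modulus2 p s) by (destruct Hp; lra).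
  replace (momentum K S p / U y)
    with (scal (sqrt (speed2 K S p s)) (phase_density K S p s)).
  - apply (is_derive_comp (primitive (phase_density K S p)) (amplitude K S p)).
    + apply is_derive_primitive, continuous_phase_density.
    + apply is_derive_amplitude.
  - unfold phase_density, dwell, U. fold s. unfold scal; cbn; unfold mult; cbn.
    field. split; lra.
Qed.

Lemma cnoidal_gl_solution (a3 a4 c Rf Tc T : R) :
  K * S * (- a4 * Rf ^ 2) = a3 * (T - Tc) ->
  2 * K * (- a4 * Rf ^ 2) = c ->
  gl_solution a3 a4 c Rf Tc T (cnoidal K S p).
Proof.
  intros HL Hc.
  set (u1 := fst p). set (u2 := snd p). set (u3 := S - u1 - u2).
  set (a := amplitude K S p).
  set (w := fun y => sqrt (speed2 K S p (a y))).
  assert (Da : forall y, is_derive a y (w y)) by apply is_derive_amplitude.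
  assert (Hs : forall y, 0 < speed2 K S p (a y)).
  { intros y. assert (H := speed2_bounds K S p (a y) HK Hp). lra. }
  assert (Hw : forall y, 0 < w y) by (intros y; apply sqrt_lt_R0, Hs).
  assert (Hw2 : forall y, w y * w y = speed2 K S p (a y))
    by (intros y; apply sqrt_sqrt, Rlt_le, Hs).
  (* Here [w = psi']; differentiating [psi'^2 = K (u3 - u)] lets a factor [psi'] cancel. *)
  assert (Dw : forall y,
    is_derive w y (- K * (u2 - u1) * sin (a y) * cos (a y))).
  { intros y.
    replace (- K * (u2 - u1) * sin (a y) * cos (a y))
      with (- (2 * K * (u2 - u1) * sin (a y) * cos (a y) * w y) / (2 * w y))
      by (specialize (Hw y); field; lra).
    apply is_derive_sqrt; [|apply Hs]. unfold speed2, modulus2.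
    assert (Ea : ex_derive a y) by (eexists; apply Da).
    auto_derive; auto.
    rewrite (is_derive_unique (fun x : R => a x) _ _ (Da y)).
    unfold u1, u2. ring. }
  assert (Hcos : forall y, cos (a y) ^ 2 = 1 - sin (a y) ^ 2).
  { intros y. assert (H := sin2_cos2 (a y)). unfold Rsqr in H. lra. }
  (* The coefficients [L], [E] and [h] come from expanding [K (u - u1) (u - u2) (u - u3)]. *)
  apply (polar_gl_solution a3 a4 c Rf Tc T (K * S) K
    (K * (u1 * u2 + u1 * u3 + u2 * u3)) (momentum K S p) U
    (fun y => 2 * (u2 - u1) * sin (a y) * cos (a y) * w y) (phase K S p)); auto.
  - intros y. assert (H := modulus2_bounds S p (a y) Hp).
    destruct Hp as [H1 _]. unfold U. fold a. lra.
  - intros y. unfold U, modulus2. fold a u1 u2.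
    assert (Ea : ex_derive a y) by (eexists; apply Da).
    auto_derive; auto.
    rewrite (is_derive_unique (fun x : R => a x) _ _ (Da y)). ring.
  - intros y. assert (Ea : ex_derive a y) by (eexists; apply Da).
    assert (Ew : ex_derive w y) by (eexists; apply Dw).
    (* The new form is the derivative of [2 (u2 - u1) sin psi cos psi psi'] with [psi''] already
       inserted. *)
    replace (2 * (K * (u1 * u2 + u1 * u3 + u2 * u3)) - 4 * (K * S) * U y
        + 6 * K * U y ^ 2)
      with (2 * (u2 - u1) * (cos (a y) ^ 2 - sin (a y) ^ 2) * (w y * w y)
        - 2 * K * (u2 - u1) ^ 2 * sin (a y) ^ 2 * cos (a y) ^ 2).
    2: { rewrite Hw2, Hcos. unfold u3, U, speed2, modulus2. fold a u1 u2. ring. }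
    auto_derive; auto.
    rewrite (is_derive_unique (fun x : R => a x) _ _ (Da y)),
      (is_derive_unique (fun x : R => w x) _ _ (Dw y)). ring.
  - apply is_derive_phase.
  - intros y. unfold momentum. rewrite pow2_sqrt.
    + replace ((2 * (u2 - u1) * sin (a y) * cos (a y) * w y) ^ 2 / 4)
        with ((u2 - u1) ^ 2 * sin (a y) ^ 2 * cos (a y) ^ 2 * (w y * w y))
        by field.
      rewrite Hw2, Hcos.
      unfold u3, U, speed2, modulus2. fold a u1 u2. ring.
    + destruct Hp as [H1 [H2 H3]].
      apply Rlt_le; repeat apply Rmult_lt_0_compat; lra.
Qed.

Lemma Cmod_cnoidal (y : R) : Cmod (cnoidal K S p y) = sqrt (U y).
Proof. apply Cmod_polar, sqrt_pos. Qed.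

(** The length in [y] over which [psi] advances by [PI], the period of [sin^2]. *)
Let P : R := primitive (dwell K S p) PI.

Lemma period_pos : 0 < P.
Proof.
  rewrite <- (primitive_0 (dwell K S p)). apply primitive_lt with lower;
    auto using continuous_dwell, lower_pos, lower_le_dwell.
  exact PI_RGT_0.
Qed.

Lemma modulus2_add_PI (s : R) : modulus2 p (s + PI) = modulus2 p s.
Proof. unfold modulus2. rewrite sin_sqr_add_PI. reflexivity. Qed.

Lemma dwell_add_PI (s : R) : dwell K S p (s + PI) = dwell K S p s.
Proof. unfold dwell, speed2. rewrite modulus2_add_PI. reflexivity. Qed.

Lemma phase_density_add_PI (s : R) :
  phase_density K S p (s + PI) = phase_density K S p s.
Proof.
  unfold phase_density. rewrite modulus2_add_PI, dwell_add_PI. reflexivity.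
Qed.

Lemma amplitude_add_period (y : R) :
  amplitude K S p (y + P) = amplitude K S p y + PI.
Proof.
  rewrite <- (amplitude_primitive (amplitude K S p y + PI)).
  rewrite primitive_periodic, primitive_amplitude;
    auto using continuous_dwell, dwell_add_PI.
Qed.

Lemma amplitude_between (Q : R) : 0 < Q < P -> 0 < amplitude K S p Q < PI.
Proof.
  intros HQ. split; apply Rnot_le_lt; intros H.
  - assert (H' := primitive_expanding (dwell K S p) 0 _ _ continuous_dwell
      (fun t => Rle_trans _ _ _ (Rlt_le _ _ lower_pos) (lower_le_dwell t)) H).
    rewrite primitive_amplitude, primitive_0 in H'. lra.
  - assert (H' := primitive_expanding (dwell K S p) 0 _ _ continuous_dwell
      (fun t => Rle_trans _ _ _ (Rlt_le _ _ lower_pos) (lower_le_dwell t)) H).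
    rewrite primitive_amplitude in H'. fold P in H'. lra.
Qed.

(** At [y = 0] the modulus is minimal; for [0 < Q < P] the angle lies strictly between 0 and [PI],
    where [sin] is positive and the minimum is exceeded. *)
Lemma least_period_modulus2 : least_period U P.
Proof.
  split; [apply period_pos|split].
  - intros y. unfold U. rewrite amplitude_add_period. apply modulus2_add_PI.
  - intros Q HQ H. specialize (H 0). rewrite Rplus_0_l in H. unfold U in H.
    rewrite <- (primitive_0 (dwell K S p)), amplitude_primitive in H.
    unfold modulus2 in H. rewrite sin_0 in H.
    destruct (amplitude_between Q HQ) as [H1 H2].
    assert (H3 := sin_gt_0 _ H1 H2).
    assert (0 < sin (amplitude K S p Q) ^ 2) by (apply pow_lt, H3).
    destruct Hp as [_ [H4 _]]. nra.
Qed.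

Lemma least_period_sqrt_modulus2 : least_period (fun y => sqrt (U y)) P.
Proof.
  destruct least_period_modulus2 as [HP [Hper Hmin]].
  split; [exact HP|split].
  - intros y. rewrite Hper. reflexivity.
  - intros Q HQ H. apply (Hmin Q HQ). intros y.
    assert (Hpos : forall z, 0 <= U z).
    { intros z. assert (H1 := modulus2_bounds S p (amplitude K S p z) Hp).
      destruct Hp as [H2 _]. unfold U. lra. }
    apply sqrt_inj; auto.
Qed.

(** The mean of [theta'] over one period. *)
Let drift : R := primitive (phase_density K S p) PI / P.

(** A smaller period would be inherited by the derivative [h / U - drift], hence by [U] since
    [h > 0], against the minimality already known for [U]. *)
Lemma least_period_phase : least_period (fun y => phase K S p y - drift * y) P.
Proof.
  split; [apply period_pos|split].
  - intros y. unfold phase. rewrite amplitude_add_period, primitive_periodic;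
      auto using continuous_phase_density, phase_density_add_PI.
    unfold drift. field. assert (H := period_pos). lra.
  - intros Q HQ H.
    destruct least_period_modulus2 as [_ [_ Hmin]]. apply (Hmin Q HQ).
    intros y.
    assert (D : forall z, is_derive (fun y => phase K S p y - drift * y) z
      (momentum K S p / U z - drift)).
    { intros z. apply (is_derive_minus (phase K S p) (fun y => drift * y)).
      - apply is_derive_phase.
      - auto_derive; auto. ring. }
    assert (D1 : is_derive (fun y => phase K S p y - drift * y) y
      (momentum K S p / U (y + Q) - drift)).
    { apply (is_derive_ext
        (fun y => phase K S p (y + Q) - drift * (y + Q))); [exact H|].
      replace (momentum K S p / U (y + Q) - drift)
        with (scal 1 (momentum K S p / U (y + Q) - drift))
        by (unfold scal; cbn; unfold mult; cbn; ring).
      apply (is_derive_comp (fun y => phase K S p y - drift * y)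
        (fun y => y + Q)); [apply D|].
      auto_derive; auto. }
    assert (E := is_derive_unique _ _ _ D1).
    rewrite (is_derive_unique _ _ _ (D y)) in E.
    assert (Hpos : forall z, 0 < U z).
    { intros z. assert (H1 := modulus2_bounds S p (amplitude K S p z) Hp).
      destruct Hp as [H2 _]. unfold U. lra. }
    assert (Hm : 0 < momentum K S p).
    { destruct Hp as [H1 [H2 H3]]. apply sqrt_lt_R0.
      repeat apply Rmult_lt_0_compat; lra. }
    apply Rinv_eq_reg, Rmult_eq_reg_l with (momentum K S p); [|lra].
    unfold Rdiv in E. lra.
Qed.

Lemma cnoidal_attains_extremes :
  (exists y, U y = fst p) /\ (exists y, U y = snd p).
Proof.
  split.
  - exists (primitive (dwell K S p) 0). unfold U.
    rewrite amplitude_primitive. unfold modulus2. rewrite sin_0. ring.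
  - exists (primitive (dwell K S p) (PI / 2)). unfold U.
    rewrite amplitude_primitive. unfold modulus2. rewrite sin_PI2. ring.
Qed.

Lemma unif_continuous_modulus2 : unif_continuous_at modulus2 p.
Proof.
  assert (Hf : continuous (fst : R * R -> R) p)
    by (destruct p; apply continuous_fst).
  assert (Hs : continuous (snd : R * R -> R) p)
    by (destruct p; apply continuous_snd).
  apply unif_continuous_plus; [apply unif_continuous_param, Hf|].
  apply unif_continuous_mult.
  - apply (unif_continuous_param (fun p : R * R => snd p - fst p)).
    apply (continuous_minus (V := R_NormedModule)); assumption.
  - apply unif_continuous_indep with 1. intros s.
    rewrite Rabs_pos_eq; apply sin_sqr_bounds.
Qed.

Lemma unif_continuous_dwell : unif_continuous_at (dwell K S) p.
Proof.
  set (m := K * (S - fst p - 2 * snd p)).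
  assert (Hm : 0 < m) by apply (speed2_bounds K S p 0 HK Hp).
  assert (Hms : forall s, m <= speed2 K S p s)
    by (intros s; apply (speed2_bounds K S p s HK Hp)).
  apply unif_continuous_inv with (sqrt m).
  - apply sqrt_lt_R0, Hm.
  - intros s. apply sqrt_le_1_alt, Hms.
  - apply unif_continuous_sqrt with m; auto.
    assert (Hf : continuous (fst : R * R -> R) p)
      by (destruct p; apply continuous_fst).
    assert (Hs : continuous (snd : R * R -> R) p)
      by (destruct p; apply continuous_snd).
    apply (unif_continuous_ext (fun (p : R * R) s =>
      K * (S - fst p - snd p) + - K * modulus2 p s)).
    { intros q s. unfold speed2. ring. }
    apply unif_continuous_plus.
    + apply (unif_continuous_param (fun p : R * R => K * (S - fst p - snd p))).
      apply (continuous_mult (K := R_AbsRing) (fun _ : R * R => K));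
        [apply continuous_const|].
      apply (continuous_minus (V := R_NormedModule)); [|exact Hs].
      apply (continuous_minus (V := R_NormedModule)); [|exact Hf].
      apply continuous_const.
    + apply unif_continuous_mult; [|apply unif_continuous_modulus2].
      apply unif_continuous_param, continuous_const.
Qed.

Lemma continuous_momentum : continuous (momentum K S) p.
Proof.
  assert (Hf : continuous (fst : R * R -> R) p)
    by (destruct p; apply continuous_fst).
  assert (Hs : continuous (snd : R * R -> R) p)
    by (destruct p; apply continuous_snd).
  apply (continuous_comp
    (fun p : R * R => K * (fst p * snd p * (S - fst p - snd p))) sqrt);
    [|apply continuous_sqrt].
  apply (continuous_mult (K := R_AbsRing) (fun _ : R * R => K));
    [apply continuous_const|].
  apply (continuous_mult (K := R_AbsRing) (fun p : R * R => fst p * snd p)).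
  - apply (continuous_mult (K := R_AbsRing) (fst : R * R -> R)); assumption.
  - apply (continuous_minus (V := R_NormedModule)); [|exact Hs].
    apply (continuous_minus (V := R_NormedModule)); [|exact Hf].
    apply continuous_const.
Qed.

Lemma unif_continuous_phase_density :
  unif_continuous_at (phase_density K S) p.
Proof.
  apply unif_continuous_mult; [|apply unif_continuous_dwell].
  apply unif_continuous_mult.
  - apply unif_continuous_param, continuous_momentum.
  - apply unif_continuous_inv with (fst p).
    + apply Hp.
    + intros s. apply (modulus2_bounds S p s Hp).
    + apply unif_continuous_modulus2.
Qed.

End Member.

(** Modulus and phase depend on the parameter twice, explicitly and through the amplitude, so
    continuity of the amplitude is established before either. *)
Lemma continuous_cnoidal (p : R * R) (y : R) :
  cnoidal_domain S p -> continuous (fun q => cnoidal K S q y) p.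
Proof.
  intros Hp. assert (Hloc := open_cnoidal_domain S p Hp).
  assert (Hf : continuous (fst : R * R -> R) p)
    by (destruct p; apply continuous_fst).
  assert (Hs : continuous (snd : R * R -> R) p)
    by (destruct p; apply continuous_snd).
  assert (Ha : continuous (fun q => amplitude K S q y) p).
  { apply continuous_primitive_inv_param with lower.
    - apply lower_pos with p, Hp.
    - revert Hloc. apply filter_imp. intros q Hq.
      split; [apply continuous_dwell, Hq | apply lower_le_dwell, Hq].
    - apply unif_continuous_dwell, Hp. }
  apply continuous_polar.
  - apply (continuous_comp
      (fun q : R * R => modulus2 q (amplitude K S q y)) sqrt);
      [|apply continuous_sqrt].
    apply (continuous_plus (V := R_NormedModule) (fst : R * R -> R)); auto.
    apply (continuous_mult (K := R_AbsRing) (fun q : R * R => snd q - fst q)).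
    + apply (continuous_minus (V := R_NormedModule)); assumption.
    + apply (continuous_comp (fun q => amplitude K S q y) (fun s => sin s ^ 2));
        [exact Ha|].
      apply (ex_derive_continuous (V := R_NormedModule)). auto_derive; auto.
  - apply (continuous_primitive_param (phase_density K S)); [| |exact Ha].
    + revert Hloc. apply filter_imp. intros q Hq.
      apply continuous_phase_density, Hq.
    + apply unif_continuous_phase_density, Hp.
Qed.

(* Translations and phases preserve the range of [|A|], hence its extremal
   values [sqrt u1] and [sqrt u2]. *)
Lemma cnoidal_equiv_inj (p q : R * R) :
  cnoidal_domain S p -> cnoidal_domain S q ->
  phase_translation_equiv (cnoidal K S p) (cnoidal K S q) -> p = q.
Proof.
  intros Hp Hq [t0 [y0 H]].
  assert (Hmod : forall y, modulus2 q (amplitude K S q y)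
    = modulus2 p (amplitude K S p (y + y0))).
  { intros y. specialize (H y). apply (f_equal Cmod) in H.
    rewrite Cmod_mult, !Cmod_cnoidal in H.
    replace (Cmod (cis t0)) with 1 in H.
    2: { rewrite <- (Cmod_polar 1 t0), Cmod_mult, Cmod_1 by lra. ring. }
    rewrite Rmult_1_l in H.
    assert (Hpos : forall r s, cnoidal_domain S r -> 0 <= modulus2 r s).
    { intros r s Hr. assert (Hb := modulus2_bounds S r s Hr).
      destruct Hr as [Hr _]. lra. }
    apply sqrt_inj; auto. }
  destruct (cnoidal_attains_extremes p Hp) as [[y1 E1] [y2 E2]].
  destruct (cnoidal_attains_extremes q Hq) as [[z1 F1] [z2 F2]].
  rewrite Hmod in F1, F2.
  (* Each of the two ranges contains the extreme values of the other; the four resulting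
     inequalities identify the end points. *)
  assert (B1 := modulus2_bounds S p (amplitude K S p (z1 + y0)) Hp).
  assert (B2 := modulus2_bounds S p (amplitude K S p (z2 + y0)) Hp).
  assert (B3 := modulus2_bounds S q (amplitude K S q (y1 - y0)) Hq).
  assert (B4 := modulus2_bounds S q (amplitude K S q (y2 - y0)) Hq).
  rewrite Hmod in B3, B4.
  replace (y1 - y0 + y0) with y1 in B3 by ring.
  replace (y2 - y0 + y0) with y2 in B4 by ring.
  apply injective_projections; lra.
Qed.

End Cnoidal.

(** * The two bifurcating families *)

Lemma plane_wave_family (a3 a4 c Rf Tc : R) :
  0 < a3 -> a4 < 0 -> 0 < c -> 0 < Rf ->
  exists (lo hi : R -> R) (A : R -> R -> R -> C),
    bifurcating_family a3 a4 c Rf Tc phase_equiv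
      (fun T beta => lo T < beta < hi T /\ beta <> 0) A /\
    forall T : R, Tc < T ->
      lo T < 0 < hi T /\
      forall beta : R, lo T < beta < hi T -> beta <> 0 ->
        nonconstant (A T beta) /\
        exists rho theta0 : R, 0 < rho /\
          forall y : R, A T beta y = (RtoC rho * cis (beta * y + theta0)%R)%C.
Proof.
  intros ha3 ha4 hc hRf.
  assert (HR2 : 0 < Rf ^ 2) by (apply pow_lt; assumption).
  assert (Hkap : 0 < - a4 * Rf ^ 2) by (apply Rmult_lt_0_compat; lra).
  (* For [T > Tc] the squared amplitude [u0] is positive exactly when [beta^2 < hi^2]. *)
  set (hi := fun T => sqrt (a3 * (T - Tc) / (- a4 * Rf ^ 2))).
  set (u0 := fun T beta => (a3 * (T - Tc) + a4 * Rf ^ 2 * beta ^ 2) / c).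
  set (A := fun T beta y => (RtoC (sqrt (u0 T beta)) * cis (beta * y))%C).
  assert (Hhi : forall T, Tc < T -> 0 < hi T).
  { intros T HT. apply sqrt_lt_R0, Rdiv_lt_0_compat; [|exact Hkap].
    apply Rmult_lt_0_compat; lra. }
  assert (Hu0 : forall T beta, Tc < T -> - hi T < beta < hi T -> 0 < u0 T beta).
  { intros T beta HT Hb. apply Rdiv_lt_0_compat; [|exact hc].
    assert (Hsq : hi T * hi T * (- a4 * Rf ^ 2) = a3 * (T - Tc)).
    { unfold hi. rewrite sqrt_sqrt; [field; lra|].
      apply Rdiv_le_0_compat; [apply Rmult_le_pos; lra | exact Hkap]. }
    rewrite <- Hsq.
    assert (0 < (hi T * hi T - beta ^ 2) * (- a4 * Rf ^ 2))
      by (apply Rmult_lt_0_compat; [nra | exact Hkap]).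
    lra. }
  assert (Hmod : forall T beta y, Cmod (A T beta y) = sqrt (u0 T beta))
    by (intros T beta y; apply Cmod_polar, sqrt_pos).
  assert (Hnz : forall T beta, Tc < T -> - hi T < beta < hi T ->
    RtoC (sqrt (u0 T beta)) <> RtoC 0).
  { intros T beta HT Hb H. apply RtoC_inj in H.
    assert (H' := sqrt_lt_R0 _ (Hu0 T beta HT Hb)). lra. }
  exists (fun T => - hi T), hi, A. split; [split; [|split; [|split]]|].
  - intros T beta HT [Hb _]. split; [|split].
    + apply plane_wave_gl_solution; auto. unfold u0. field. lra.
    + exists 0. apply Cmod_gt_0. rewrite Hmod. apply sqrt_lt_R0, Hu0; auto.
    + exists (sqrt (u0 T beta)). intros y. rewrite Hmod. apply Rle_refl.
  - intros T y _. apply continuous_on_forall. intros beta _.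
    apply continuous_polar.
    + apply (continuous_comp (u0 T) sqrt); [|apply continuous_sqrt].
      apply (ex_derive_continuous (V := R_NormedModule)).
      unfold u0. auto_derive; auto.
    + apply (ex_derive_continuous (V := R_NormedModule)). auto_derive; auto.
  - intros T b b' HT [Hb _] [Hb' _] Hne [t0 H]. apply Hne.
    apply (cis_linear_inj (cis t0 * RtoC (sqrt (u0 T b)))%C
      (RtoC (sqrt (u0 T b')))).
    { apply Hnz; auto. }
    intros y. rewrite <- Cmult_assoc. apply H.
  - apply family_sup_bifurcates with (a3 / c).
    + intros T HT. exists (hi T / 2). specialize (Hhi T HT). split; lra.
    + intros T beta y HT _. rewrite Hmod. apply sqrt_le_1_alt.
      replace (a3 / c * (T - Tc)) with (a3 * (T - Tc) / c) by (field; lra).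
      apply Rmult_le_compat_r; [apply Rlt_le, Rinv_0_lt_compat, hc|].
      assert (H : 0 <= - a4 * Rf ^ 2 * beta ^ 2)
        by (apply Rmult_le_pos; [lra | apply pow2_ge_0]).
      lra.
  - intros T HT. assert (HhT := Hhi T HT). split; [lra|].
    intros beta Hb Hb0. split.
    + apply NNPP. intros Hc. apply Hb0.
      (* A constant member is compared with a wave of wave number 0. *)
      symmetry. apply (cis_linear_inj (A T beta 0) (RtoC (sqrt (u0 T beta)))).
      { apply Hnz; auto. }
      intros y. rewrite Rmult_0_l, cis_0, Cmult_1_r.
      apply NNPP. intros Hy. apply Hc. exists y, 0. exact Hy.
    + exists (sqrt (u0 T beta)), 0. split; [apply sqrt_lt_R0, Hu0; auto|].
      intros y. rewrite Rplus_0_r. reflexivity.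
Qed.

Lemma cnoidal_family (a3 a4 c Rf Tc : R) :
  0 < a3 -> a4 < 0 -> 0 < c -> 0 < Rf ->
  exists (Om : R -> R * R -> Prop) (A : R -> R * R -> R -> C),
    bifurcating_family a3 a4 c Rf Tc phase_translation_equiv Om A /\
    forall T : R, Tc < T ->
      open (Om T) /\ (exists p : R * R, Om T p) /\
      forall p : R * R, Om T p ->
        nonconstant (A T p) /\
        exists (rho phi : R -> R) (beta' theta0 P : R),
          (forall y : R, 0 < rho y) /\
          nonconstant rho /\ least_period rho P /\
          (forall y : R, continuous phi y) /\
          nonconstant phi /\ least_period phi P /\
          forall y : R,
            A T p y = (RtoC (rho y) * cis (beta' * y + theta0 + phi y)%R)%C.
Proof.
  intros ha3 ha4 hc hRf.
  assert (HR2 : 0 < Rf ^ 2) by (apply pow_lt; assumption).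
  assert (Hkap : 0 < - a4 * Rf ^ 2) by (apply Rmult_lt_0_compat; lra).
  (* Matching the cubic forces [K], and the root sum [S = L / K], from which [a4] and [Rf]
     cancel. *)
  set (K := c / (2 * (- a4 * Rf ^ 2))).
  assert (HK : 0 < K) by (apply Rdiv_lt_0_compat; lra).
  set (S := fun T => 2 * a3 * (T - Tc) / c).
  assert (HS : forall T, Tc < T -> 0 < S T).
  { intros T HT. apply Rdiv_lt_0_compat; [|exact hc].
    apply Rmult_lt_0_compat; lra. }
  assert (Hpos : forall T p s, cnoidal_domain (S T) p -> 0 < modulus2 p s).
  { intros T p s Hp. assert (H := modulus2_bounds _ _ s Hp).
    destruct Hp as [Hp _]. lra. }
  assert (Hne : forall T, Tc < T -> exists p, cnoidal_domain (S T) p).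
  { intros T HT. exists (S T / 8, S T / 4). specialize (HS T HT).
    unfold cnoidal_domain; simpl. lra. }
  assert (Hbound : forall T p y, Tc < T -> cnoidal_domain (S T) p ->
    Cmod (cnoidal K (S T) p y) <= sqrt (a3 / c * (T - Tc))).
  { intros T p y HT Hp. rewrite Cmod_cnoidal. apply sqrt_le_1_alt.
    assert (H := modulus2_bounds _ _ (amplitude K (S T) p y) Hp).
    destruct Hp as [H1 [H2 H3]].
    (* From [0 < u1] and [u1 + 2 u2 < S] follows [u <= u2 < S / 2]. *)
    replace (a3 / c * (T - Tc)) with (S T / 2) by (unfold S; field; lra).
    lra. }
  exists (fun T => cnoidal_domain (S T)), (fun T => cnoidal K (S T)).
  split; [split; [|split; [|split]]|].
  - intros T p HT Hp. split; [|split].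
    + apply cnoidal_gl_solution; auto; unfold K, S; field; lra.
    + exists 0. apply Cmod_gt_0. rewrite Cmod_cnoidal.
      apply sqrt_lt_R0, (Hpos T), Hp.
    + exists (sqrt (a3 / c * (T - Tc))). intros y. apply Hbound; auto.
  - intros T y _. intros p Hp.
    apply (filterlim_filter_le_1 (F := locally p)
      (G := within (cnoidal_domain (S T)) (locally p))).
    { intros Q. unfold within. apply filter_imp. auto. }
    apply continuous_cnoidal; auto.
  - intros T p q _ Hp Hq Hpq H. apply Hpq.
    apply (cnoidal_equiv_inj K (S T)); auto.
  - apply family_sup_bifurcates with (a3 / c); auto.
  - intros T HT. split; [apply open_cnoidal_domain|]. split; [auto|].
    intros p Hp.
    assert (Hrho := least_period_sqrt_modulus2 K (S T) HK p Hp).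
    assert (Hphi := least_period_phase K (S T) HK p Hp).
    cbv zeta in Hrho, Hphi.
    set (P := primitive (dwell K (S T) p) PI) in *.
    set (beta' := primitive (phase_density K (S T) p) PI / P) in *.
    split.
    + destruct (least_period_nonconstant _ _ Hrho) as [y [z Hyz]].
      exists y, z. intros E. apply Hyz. rewrite <- !Cmod_cnoidal, E. reflexivity.
    + exists (fun y => sqrt (modulus2 p (amplitude K (S T) p y))).
      exists (fun y => phase K (S T) p y - beta' * y), beta', 0, P.
      split; [intros y; apply sqrt_lt_R0, (Hpos T), Hp|].
      split; [apply (least_period_nonconstant _ _ Hrho)|].
      split; [exact Hrho|].
      split.
      { intros y. apply (continuous_minus (V := R_NormedModule)).
        - apply (ex_derive_continuous (V := R_NormedModule)). eexists.
          apply is_derive_phase; auto.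
        - apply (ex_derive_continuous (V := R_NormedModule)).
          auto_derive; auto. }
      split; [apply (least_period_nonconstant _ _ Hphi)|].
      split; [exact Hphi|].
      intros y. unfold cnoidal. f_equal. f_equal. ring.
Qed.

Theorem theorem1p4 (a3 a4 c Rf Tc : R)
    (ha3 : 0 < a3) (ha4 : a4 < 0) (hc : 0 < c) (hRf : 0 < Rf) (hTc : 0 < Tc) :
  (forall T : R, Tc < T ->
     gl_solution a3 a4 c Rf Tc T (fun _ => RtoC 0) /\
     exists z : C, z <> RtoC 0 /\ gl_solution a3 a4 c Rf Tc T (fun _ => z)) /\
  (exists (lo hi : R -> R) (A : R -> R -> R -> C),
     bifurcating_family a3 a4 c Rf Tc phase_equiv
       (fun T beta => lo T < beta < hi T /\ beta <> 0) A /\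
     forall T : R, Tc < T ->
       lo T < 0 < hi T /\
       forall beta : R, lo T < beta < hi T -> beta <> 0 ->
         nonconstant (A T beta) /\
         exists rho theta0 : R, 0 < rho /\
           forall y : R, A T beta y = (RtoC rho * cis (beta * y + theta0)%R)%C) /\
  (exists (Om : R -> R * R -> Prop) (A : R -> R * R -> R -> C),
     bifurcating_family a3 a4 c Rf Tc phase_translation_equiv Om A /\
     forall T : R, Tc < T ->
       open (Om T) /\ (exists p : R * R, Om T p) /\
       forall p : R * R, Om T p ->
         nonconstant (A T p) /\
         exists (rho phi : R -> R) (beta' theta0 P : R),
           (forall y : R, 0 < rho y) /\
           nonconstant rho /\ least_period rho P /\
           (forall y : R, continuous phi y) /\
           nonconstant phi /\ least_period phi P /\
           forall y : R,
             A T p y = (RtoC (rho y) * cis (beta' * y + theta0 + phi y)%R)%C).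
Proof.
  split; [|split; [apply plane_wave_family | apply cnoidal_family]; assumption].
  intros T HT. split.
  - exists (fun _ => RtoC 0), (fun _ => RtoC 0). intros y.
    assert (D := is_derive_const (K := R_AbsRing) (V := C_R_NormedModule)
      (RtoC 0) y).
    split; [exact D | split; [exact D | ring]].
  - set (u0 := a3 * (T - Tc) / c).
    assert (Hu0 : 0 < u0)
      by (apply Rdiv_lt_0_compat; [apply Rmult_lt_0_compat|]; lra).
    exists (RtoC (sqrt u0)). split.
    + intros H. apply RtoC_inj in H. assert (H' := sqrt_lt_R0 u0 Hu0). lra.
    (* A nonzero constant solution is a plane wave of wave number 0. *)
    + replace (fun _ : R => RtoC (sqrt u0))
        with (fun y => RtoC (sqrt u0) * cis (0 * y))%C.
      * apply plane_wave_gl_solution; auto. unfold u0. field. lra.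
      * apply functional_extensionality. intros y.
        rewrite Rmult_0_l, cis_0. apply Cmult_1_r.
Qed.
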